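(* Let $\Sigma$ be a simple smooth curve embedded in $\mathbb{R}^3$ that is a closed subset of $\mathbb{R}^3$, and let $\rho(\mathbf{x})=\inf_{\mathbf{y}\in\Sigma}|\mathbf{x}-\mathbf{y}|$ be the Euclidean distance function to $\Sigma$. Then, as distributions on $\mathbb{R}^3$, $$\delta_\Sigma(\mathbf{x})=\frac{\delta(\rho)}{2\pi\rho},$$ that is, for every $f\in C_c^\infty(\mathbb{R}^3)$, $$\int_{\mathbb{R}^3}\frac{\delta(\rho)}{2\pi\rho}\,f(\mathbf{x})\,d\mathbf{x}=\int_\Sigma f(\mathbf{x}(s))\,ds .$$
   Context: A simple smooth curve embedded in $\mathbb{R}^3$ means a connected one-dimensional smooth embedded submanifold of $\mathbb{R}^3$, possibly with endpoints and possibly of infinite length; $s$ is the arc length parameter and $\mathbf{x}(s)$ the corresponding point of $\Sigma$. Line delta function: $\delta_\Sigma$ is the distribution defined by $\int_{\mathbb{R}^3}\delta_\Sigma(\mathbf{x})f(\mathbf{x})\,d\mathbf{x}=\int_\Sigma f(\mathbf{x}(s))\,ds$ for all $f\in C_c^\infty(\mathbb{R}^3)$. One-dimensional delta: since $\rho\ge 0$, the convention is $\int_0^\infty\delta(t)g(t)\,dt=g(0)$. Meaning of $\int_{\mathbb{R}^3}\frac{\delta(\rho)}{2\pi\rho}f\,d\mathbf{x}$: $\delta(\rho)$ is supported on $\Sigma$, and the integral is computed in local cylindrical coordinates in tubular neighbourhoods, as follows. For a compact piece $\Sigma_i=\{\mathbf{x}(s):s\in[a_i,b_i]\}$ of $\Sigma$,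 choose smooth unit vector fields $U,V$ along $\Sigma_i$ such that $(U,V,\frac{\partial}{\partial s})$ is a right-handed orthonormal frame, where $\frac{\partial}{\partial s}$ is the unit tangent. For $\epsilon_i>0$ small, the map $$(\rho,\theta,s)\mapsto \mathbf{x}(\rho,\theta,s)=\mathbf{x}(s)+\rho\cos\theta\,U(s)+\rho\sin\theta\,V(s),\quad 0\le\rho<\epsilon_i,\ \theta\in[0,2\pi),\ s\in[a_i,b_i],$$ gives (polar-type) coordinates on the tubular neighbourhood of $\Sigma_i$ formed by the normal discs of radius $\epsilon_i$, the coordinate $\rho$ is the distance to $\Sigma$, and the Jacobian determinant $J_i(\rho,\theta,s)=\det\frac{\partial(x,y,z)}{\partial(\rho,\theta,s)}$ is smooth, positive for $\rho>0$, and vanishes at $\rho=0$. Given $f\in C_c^\infty(\mathbb{R}^3)$, choose finitely many such pieces $\Sigma_i$ and functions $h_i\in C_c^\infty(\mathbb{R}^3)$ with $\operatorname{supp}h_i\cap\Sigma\subset\Sigma_i$ and $\sum_i h_i=1$ on a neighbourhood of $\Sigma\cap\operatorname{supp}f$. Then $$\int_{\mathbb{R}^3}\frac{\delta(\rho)}{2\pi\rho}f\,d\mathbf{x}=\sum_i\int_{a_i}^{b_i}\int_0^{2\pi}\left[\int_0^{\epsilon_i}\delta(\rho)\,\frac{(f h_i)(\mathbf{x}(\rho,\theta,s))\,J_i(\rho,\theta,s)}{2\pi\rho}\,d\rho\right]d\theta\,ds,$$ where the inner integral is the value at $\rho=0$ of the continuous extension to $\rho=0$ of $\rho\mapsto \frac{(fh_i)J_i}{2\pi\rho}$.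 The asserted identity holds for every such choice of pieces, frames and functions $h_i$. *)

(* Defs.v *)
(* MathComp-Analysis.  R^3 is 'rV[R]_3; its library norm `|.| is the sup norm,
   which is used only for topology and differentiability. *)
From HB Require Import structures.
From mathcomp Require Import all_boot all_order all_algebra.
From mathcomp Require Import all_classical all_reals all_analysis.

Set Implicit Arguments.
Unset Strict Implicit.
Unset Printing Implicit Defensive.

Import Order.TTheory GRing.Theory Num.Theory.
Import numFieldNormedType.Exports.

Local Open Scope classical_set_scope.
Local Open Scope ring_scope.

Definition dot3 (R : realType) (u v : 'rV[R]_3) : R := \sum_i u 0 i * v 0 i.

Definition enorm (R : realType) (u : 'rV[R]_3) : R := Num.sqrt (dot3 u u).

Definition rho (R : realType) (Sigma : set 'rV[R]_3) (p : 'rV[R]_3) : R :=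
  inf [set enorm (p - q) | q in Sigma].

(* C^n on W; meant for W open and V finite-dimensional. *)
Fixpoint Cn (R : realType) (V U : normedModType R) (n : nat) (W : set V)
    (f : V -> U) : Prop :=
  if n is m.+1 then
    (forall p, W p -> differentiable f p) /\
    (forall v : V, Cn m W (fun p => 'D_v f p))
  else forall p, W p -> {for p, continuous f}.

Definition smooth_on (R : realType) (V U : normedModType R) (W : set V)
    (f : V -> U) : Prop := forall n, Cn n W f.

Definition smooth (R : realType) (V U : normedModType R) (f : V -> U) : Prop :=
  smooth_on setT f.

Definition supp (R : realType) (f : 'rV[R]_3 -> R) : set 'rV[R]_3 :=
  closure [set p | f p != 0].

Definition test_function (R : realType) (f : 'rV[R]_3 -> R) : Prop :=
  smooth f /\ compact (supp f).

(* Slice charts: a diffeomorphism phi between open sets of R^3, with inverse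
   psi, straightens Sigma to the first coordinate axis, or to its nonnegative
   half near an endpoint. *)
Definition submanifold1 (R : realType) (Sigma : set 'rV[R]_3) : Prop :=
  forall p, Sigma p ->
  exists (W : set 'rV[R]_3) (phi psi : 'rV[R]_3 -> 'rV[R]_3),
    [/\ open W /\ W p,
        open (phi @` W),
        smooth_on W phi /\ smooth_on (phi @` W) psi,
        (forall q, W q -> psi (phi q) = q) &
        (forall q, W q -> Sigma q <-> phi q 0 1 = 0 /\ phi q 0 2%:R = 0) \/
        (forall q, W q -> Sigma q <->
           [/\ phi q 0 1 = 0, phi q 0 2%:R = 0 & 0 <= phi q 0 0])].

Definition simple_smooth_curve (R : realType) (Sigma : set 'rV[R]_3) : Prop :=
  submanifold1 Sigma /\ connected Sigma.

(* Arc length parametrisation x of Sigma.  The parameter ranges over J, and D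
   is a part of J on which Sigma is run through once.  There are two cases:
   an arc, for which D = J is a nondegenerate interval and x is a homeomorphism
   from J onto Sigma; and a loop of length L, for which x is L-periodic on
   J = R and D = [0, L].
   Smoothness up to an endpoint of J means that x extends smoothly; the values
   of x outside J stand for such an extension and are otherwise irrelevant. *)
Definition arc_length_param (R : realType) (Sigma : set 'rV[R]_3)
    (x : R -> 'rV[R]_3) (J D : set R) : Prop :=
  [/\ smooth x,
      (forall s, J s -> enorm (x^`()%classic s) = 1),
      x @` J = Sigma &
      [/\ is_interval J,
          (exists s t, [/\ J s, J t & s < t]),
          D = J &
          (exists2 g : 'rV[R]_3 -> R, {within Sigma, continuous g} &
             forall s, J s -> g (x s) = s)] \/
      [/\ J = setT &
          exists2 L : R, 0 < L & D = `[0, L]%classic /\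
            forall s t, x s = x t <-> exists k : int, t = s + k%:~R * L]].

Definition line_integrable (R : realType) (x : R -> 'rV[R]_3) (D : set R)
    (f : 'rV[R]_3 -> R) : Prop :=
  (@lebesgue_measure R).-integrable D (fun s => (f (x s))%:E).

Definition line_integral (R : realType) (x : R -> 'rV[R]_3) (D : set R)
    (f : 'rV[R]_3 -> R) : R :=
  \int[@lebesgue_measure R]_(s in D) f (x s).

(* A compact piece x([a, b]) with its normal fields U, V, the radius eps of its
   tube, and the cut-off function h attached to it.  As for x, only the values
   of U and V on [a, b] matter. *)
Record piece (R : realType) := Piece {
  pa : R;
  pb : R;
  peps : R;
  pU : R -> 'rV[R]_3;
  pV : R -> 'rV[R]_3;
  ph : 'rV[R]_3 -> R }.

Definition right_handed_orthonormal (R : realType) (u v w : 'rV[R]_3) : Prop :=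
  [/\ enorm u = 1 /\ enorm v = 1 /\ enorm w = 1,
      dot3 u v = 0 /\ dot3 v w = 0 /\ dot3 u w = 0 &
      0 < \det (\matrix_(i < 3) nth 0 [:: u; v; w] i)].

Definition tube (R : realType) (x : R -> 'rV[R]_3) (P : piece R)
    (r theta s : R) : 'rV[R]_3 :=
  x s + (r * cos theta) *: pU P s + (r * sin theta) *: pV P s.

Definition tube_jacobian (R : realType) (x : R -> 'rV[R]_3) (P : piece R)
    (r theta s : R) : R :=
  \det ('J (fun q : 'rV[R]_3 => tube x P (q 0 0) (q 0 1) (q 0 2%:R))
           (\row_(j < 3) nth 0 [:: r; theta; s] j)).

(* eps is small enough for (r, theta, s) to be polar-type coordinates whose
   first coordinate is the distance to Sigma.  Since s and s' range over
   [a, b), the piece may be an entire loop. *)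
Definition tubular (R : realType) (Sigma : set 'rV[R]_3) (x : R -> 'rV[R]_3)
    (P : piece R) : Prop :=
  [/\ 0 < peps P,
      (forall r theta s r' theta' s' : R,
         0 <= r < peps P -> 0 <= theta < 2 * pi -> pa P <= s < pb P ->
         0 <= r' < peps P -> 0 <= theta' < 2 * pi -> pa P <= s' < pb P ->
         tube x P r theta s = tube x P r' theta' s' ->
         [/\ r = r', s = s' & 0 < r -> theta = theta']),
      (forall r theta s : R,
         0 <= r < peps P -> 0 <= theta < 2 * pi -> pa P <= s <= pb P ->
         rho Sigma (tube x P r theta s) = r) &
      (forall r theta s : R,
         0 < r < peps P -> 0 <= theta < 2 * pi -> pa P <= s <= pb P ->
         0 < tube_jacobian x P r theta s)].

Definition admissible_piece (R : realType) (Sigma : set 'rV[R]_3)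
    (x : R -> 'rV[R]_3) (J : set R) (P : piece R) : Prop :=
  [/\ pa P < pb P /\ `[pa P, pb P]%classic `<=` J,
      smooth (pU P) /\ smooth (pV P),
      (forall s, pa P <= s <= pb P ->
         right_handed_orthonormal (pU P s) (pV P s) (x^`()%classic s)),
      tubular Sigma x P &
      test_function (ph P) /\ supp (ph P) `&` Sigma `<=` x @` `[pa P, pb P]%classic].

Definition admissible_choice (R : realType) (Sigma : set 'rV[R]_3)
    (x : R -> 'rV[R]_3) (J : set R) (f : 'rV[R]_3 -> R)
    (n : nat) (P : 'I_n -> piece R) : Prop :=
  (forall i, admissible_piece Sigma x J (P i)) /\
  (forall p, Sigma p -> supp f p -> \forall q \near p, \sum_i ph (P i) q = 1).

(* \int_0^oo delta(r) g(r) dr, with g extended continuously to 0. *)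
Definition delta0 (R : realType) (g : R -> R) : R := lim (g r @[r --> 0^'+]).

Definition polar_integrand (R : realType) (x : R -> 'rV[R]_3) (P : piece R)
    (f : 'rV[R]_3 -> R) (s theta r : R) : R :=
  f (tube x P r theta s) * ph P (tube x P r theta s)
    * tube_jacobian x P r theta s / (2 * pi * r).

Definition delta_rho_integral (R : realType) (x : R -> 'rV[R]_3)
    (n : nat) (P : 'I_n -> piece R) (f : 'rV[R]_3 -> R) : R :=
  \sum_(i < n)
    \int[@lebesgue_measure R]_(s in `[pa (P i), pb (P i)])
      \int[@lebesgue_measure R]_(theta in `[0, 2 * pi])
        delta0 (polar_integrand x (P i) f s theta).

(* lim and the integrals are total functions in the library; this says that
   the continuous extensions and the integrals above do exist. *)
Definition delta_rho_defined (R : realType) (x : R -> 'rV[R]_3)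
    (n : nat) (P : 'I_n -> piece R) (f : 'rV[R]_3 -> R) : Prop :=
  forall i,
  [/\ (forall s theta : R, pa (P i) <= s <= pb (P i) -> 0 <= theta <= 2 * pi ->
         cvg (polar_integrand x (P i) f s theta r @[r --> 0^'+])),
      (forall s : R, pa (P i) <= s <= pb (P i) ->
         (@lebesgue_measure R).-integrable `[0, 2 * pi]
           (fun theta => (delta0 (polar_integrand x (P i) f s theta))%:E)) &
      (@lebesgue_measure R).-integrable `[pa (P i), pb (P i)]
        (fun s => (\int[@lebesgue_measure R]_(theta in `[0, 2 * pi])
                     delta0 (polar_integrand x (P i) f s theta))%:E)].

(* Main.v *)
(* In the coordinates (r, theta, s) the tube map has Jacobian
   r (det (U, V, x') + r m), where m = det (U, V, Y) for
   Y = cos theta U' + sin theta V'; the frame is orthonormal and right-handed,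
   so that det (U, V, x') = 1.  Dividing by 2 pi r and letting r tend to 0 leaves
   (f h)(x(s)) / (2 pi), and integrating over theta turns it into (f h)(x(s)).
   As h vanishes on the part of Sigma outside the piece, its integral over [a, b]
   is the integral over the whole of Sigma (for a loop: injectivity of the tube on
   [a, b) forces b - a <= L, and the integral of an L-periodic function over a
   period does not depend on the period).  Summing over the pieces removes the
   partition of unity. *)
Require Import Defs.
From mathcomp Require Import all_boot all_order all_algebra.
From mathcomp Require Import all_classical all_reals all_analysis.
From mathcomp Require Import ring lra zify.
Import Order.TTheory GRing.Theory Num.Theory.
Import numFieldNormedType.Exports.
Local Open Scope classical_set_scope.
Local Open Scope ring_scope.

(** * Scalar triple products and the Jacobian of the tube map *)

(** The matrix is literally the one in [right_handed_orthonormal], so that the two determinants are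
    convertible. *)
Definition triple (R : realType) (u v w : 'rV[R]_3) : R :=
  \det (\matrix_(i < 3) nth 0 [:: u; v; w] i).

Lemma tripleE (R : realType) (u v w : 'rV[R]_3) :
  triple R u v w =
    u 0 0 * (v 0 1 * w 0 2%:R - v 0 2%:R * w 0 1)
    - u 0 1 * (v 0 0 * w 0 2%:R - v 0 2%:R * w 0 0)
    + u 0 2%:R * (v 0 0 * w 0 1 - v 0 1 * w 0 0).
Proof.
(* Cofactor expansion produces ordinals that differ syntactically from 0, 1, 2. Indexing the entries
   by natural numbers lets [ring] identify equal ones. *)
pose e (a : 'rV[R]_3) (n : nat) : R := a 0 (inord n).
have eE (a : 'rV[R]_3) i : a 0 i = e a i by rewrite /e inord_val.
rewrite /triple (expand_det_row _ 0) !big_ord_recl big_ord0.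
rewrite /cofactor !(expand_det_row _ 0) !big_ord_recl !big_ord0.
rewrite /cofactor !det_mx11 !mxE /= !eE /= /bump /=.
ring.
Qed.

Lemma differentiable_rV (R : realType) (V : normedModType R) n
    (F : V -> 'rV[R]_n) p :
  (forall j, differentiable (fun q => F q 0 j) p) -> differentiable F p.
Proof.
move=> dF; rewrite (_ : F = \sum_(j < n) (fun q => F q 0 j *: delta_mx 0 j)).
  by apply: differentiable_sum => j; exact: differentiableZl.
by apply/funext => q; rewrite fct_sumE; exact: row_sum_delta.
Qed.

Lemma is_diff_coord (R : realType) m n (M : 'M[R]_(m, n)) i j :
  is_diff M (fun N : 'M[R]_(m, n) => N i j : R) (fun N => N i j).
Proof.
have dM := differentiable_coord M i j.
apply: DiffDef => //; apply/funext => v; rewrite -deriveE //.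
have /matrixP/(_ i j) := derive_id M v.
by rewrite derive_mx ?mxE //; exact: derivable_id.
Qed.

Lemma is_diff_comp_coord (R : realType) m n (M : 'M[R]_(m, n)) i j
    (g : R -> R) (dg : R) : is_derive (M i j) (1 : R) g dg ->
  is_diff M (fun N : 'M[R]_(m, n) => g (N i j)) (fun N => N i j * dg).
Proof.
move=> [dgM gE]; have dc := is_diff_coord R m n M i j.
have dg' : is_diff (M i j) g ( *:%R^~ dg).
  apply: DiffDef; first exact/derivable1_diffP.
  by rewrite deriv1E // derive1E gE.
exact: (is_diff_comp (f := fun N : 'M[R]_(m, n) => N i j)).
Qed.

Lemma smooth_continuous (R : realType) (V U : normedModType R) (f : V -> U) :
  smooth f -> continuous f.
Proof. by move=> /(_ 0%N) sf p; exact: sf. Qed.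

Lemma smooth_derivable (R : realType) (U : normedModType R) (f : R -> U) s :
  smooth f -> derivable f s 1.
Proof. by move=> /(_ 1%N)[sf _]; exact/derivable1_diffP/sf. Qed.

Lemma is_derive_coord (R : realType) n (g : R -> 'rV[R]_n) s j :
  derivable g s 1 -> is_derive s (1 : R) (fun t => g t 0 j) (g^`()%classic s 0 j).
Proof.
move=> dg; have dgj := (derivable_mxP _ _ _).1 dg 0 j.
by apply: DeriveDef => //; rewrite derive1E derive_mx // mxE.
Qed.

(** With row vectors, row i of ['J F p] is the derivative of [F] along the i-th basis vector.
    Coordinatewise differentials give all its entries. *)
Lemma jacobian_triple (R : realType) (F : 'rV[R]_3 -> 'rV[R]_3) p
    (dF : 'rV[R]_3 -> 'rV[R]_3) :
  (forall j, is_diff p (fun q => F q 0 j) (fun v => dF v 0 j)) ->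
  \det ('J F p) =
    triple R (dF (delta_mx 0 0)) (dF (delta_mx 0 1)) (dF (delta_mx 0 2%:R)).
Proof.
move=> dFj.
have Fp : differentiable F p by apply: differentiable_rV => j; exact: ex_diff.
congr (\det _); apply/matrixP => i j; rewrite [RHS]mxE.
have -> : 'J F p i j = dF (delta_mx 0 i) 0 j.
  have -> : 'J F p i j = ('D_(delta_mx 0 i) F p) 0 j.
    by rewrite deriveEjacobian // -rowE [RHS]mxE.
  rewrite derive_mx ?mxE; last exact: diff_derivable.
  by rewrite deriveE; [rewrite diff_val|exact: ex_diff].
by case: i => -[|[|[|//]]] ? /=; congr (dF (delta_mx _ _) 0 j); apply/val_inj.
Qed.

Lemma tripleDZr (R : realType) (u v w w' : 'rV[R]_3) (a : R) :
  triple R u v (w + a *: w') = triple R u v w + a * triple R u v w'.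
Proof.
rewrite !tripleE !mxE.
move: (u 0 0) (u 0 1) (u 0 2%:R) (v 0 0) (v 0 1) (v 0 2%:R).
move: (w 0 0) (w 0 1) (w 0 2%:R) (w' 0 0) (w' 0 1) (w' 0 2%:R).
move=> *; ring.
Qed.

(** The plane map taking (u, v) to (a u + b v, a v - b u) has determinant a^2 + b^2 = 1; the factor
    r comes out by linearity in the second argument. *)
Lemma triple_polar (R : realType) (u v w : 'rV[R]_3) (a b r : R) :
  a ^+ 2 + b ^+ 2 = 1 ->
  triple R (a *: u + b *: v) (r *: (a *: v - b *: u)) w = r * triple R u v w.
Proof.
move=> ab; rewrite -[RHS]mul1r -ab !tripleE !mxE.
move: (u 0 0) (u 0 1) (u 0 2%:R) (v 0 0) (v 0 1) (v 0 2%:R).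
move: (w 0 0) (w 0 1) (w 0 2%:R) => *; ring.
Qed.

Lemma tube_jacobianE (R : realType) (x : R -> 'rV[R]_3) (P : piece R)
    (r theta s : R) :
  smooth x -> smooth (pU P) -> smooth (pV P) ->
  tube_jacobian x P r theta s =
    r * (triple R (pU P s) (pV P s) (x^`()%classic s) +
         r * triple R (pU P s) (pV P s)
           (cos theta *: (pU P)^`()%classic s + sin theta *: (pV P)^`()%classic s)).
Proof.
move=> sx sU sV; rewrite /tube_jacobian.
set p := \row_j _.
have p0 : p 0 0 = r by rewrite mxE.
have p1 : p 0 1 = theta by rewrite mxE.
have p2 : p 0 2%:R = s by rewrite mxE.
(* The candidate differential: the vectors multiplying the coordinates of [v] are the partial
   derivatives of the tube map in r, theta and s. *)
pose dF (v : 'rV[R]_3) : 'rV[R]_3 :=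
  v 0 0 *: (cos theta *: pU P s + sin theta *: pV P s)
  + v 0 1 *: (r *: (cos theta *: pV P s - sin theta *: pU P s))
  + v 0 2%:R *: (x^`()%classic s + r *: (cos theta *: (pU P)^`()%classic s
     + sin theta *: (pV P)^`()%classic s)).
set F := (fun q : 'rV[R]_3 => _).
have dFj j : is_diff p (fun q => F q 0 j) (fun v => dF v 0 j).
  have dc (g : R -> 'rV[R]_3) : smooth g ->
      is_diff p (fun q => g (q 0 2%:R) 0 j) (fun v => v 0 2%:R * g^`()%classic s 0 j).
    move=> sg; apply: (is_diff_comp_coord _ _ _ _ _ _ (fun t => g t 0 j)).
    by rewrite p2; exact/is_derive_coord/smooth_derivable.
  have dx := dc _ sx; have dU := dc _ sU; have dV := dc _ sV.
  have dr := is_diff_coord R _ _ p 0 0.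
  have dcos : is_diff p (fun q => cos (q 0 1)) (fun v => v 0 1 * - sin theta).
    by apply: (is_diff_comp_coord R _ _ p 0 1 cos); rewrite p1; exact: is_derive_cos.
  have dsin : is_diff p (fun q => sin (q 0 1)) (fun v => v 0 1 * cos theta).
    by apply: (is_diff_comp_coord R _ _ p 0 1 sin); rewrite p1; exact: is_derive_sin.
  have d1 := is_diffD dx (is_diffM (is_diffM dr dcos) dU).
  have d2 := is_diffD d1 (is_diffM (is_diffM dr dsin) dV).
  rewrite (_ : (fun q => F q 0 j) = (fun q => x (q 0 2%:R) 0 j) +
     (fun q => q 0 0) * (fun q => cos (q 0 1)) * (fun q => pU P (q 0 2%:R) 0 j) +
     (fun q => q 0 0) * (fun q => sin (q 0 1)) * (fun q => pV P (q 0 2%:R) 0 j)); last first.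
    by apply/funext => q; rewrite /F /tube !mxE.
  apply: is_diff_eq; apply/funext => v.
  (* The differential given by the sum and product rules is evaluated at [v], turning an identity of
     functions into one of real numbers. *)
  change (v 0 2%:R * x^`()%classic s 0 j +
    (p 0 0 * cos (p 0 1) * (v 0 2%:R * (pU P)^`()%classic s 0 j) +
     pU P (p 0 2%:R) 0 j * (p 0 0 * (v 0 1 * - sin theta) + cos (p 0 1) * v 0 0)) +
    (p 0 0 * sin (p 0 1) * (v 0 2%:R * (pV P)^`()%classic s 0 j) +
     pV P (p 0 2%:R) 0 j * (p 0 0 * (v 0 1 * cos theta) + sin (p 0 1) * v 0 0)) =
    dF v 0 j).
  rewrite p0 p1 p2 /dF !mxE.
  move: (x^`()%classic s 0 j) ((pU P)^`()%classic s 0 j) ((pV P)^`()%classic s 0 j).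
  move: (pU P s 0 j) (pV P s 0 j) (v 0 0) (v 0 1) (v 0 2%:R) (cos theta) (sin theta).
  move=> *; ring.
rewrite (jacobian_triple R F p dF dFj) /dF.
rewrite !mxE !eqxx /= !(scale1r, scale0r, addr0, add0r).
by rewrite triple_polar ?cos2Dsin2 // tripleDZr.
Qed.

(** * Orthonormal frames and the radial limit *)

Lemma dot3C (R : realType) (u v : 'rV[R]_3) : dot3 u v = dot3 v u.
Proof. by apply: eq_bigr => i _; rewrite mulrC. Qed.

Lemma enorm1_dot3 (R : realType) (u : 'rV[R]_3) : enorm u = 1 -> dot3 u u = 1.
Proof.
move=> u1; rewrite -[LHS]sqr_sqrtr ?[Num.sqrt _]u1 ?expr1n //.
by rewrite sumr_ge0 // => i _; rewrite -expr2 sqr_ge0.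
Qed.

(** The Gram matrix of the frame is the identity, so the determinant squares to 1; positivity
    selects the root 1. *)
Lemma right_handed_orthonormal_triple (R : realType) (u v w : 'rV[R]_3) :
  right_handed_orthonormal u v w -> triple R u v w = 1.
Proof.
move=> [[/enorm1_dot3 uu [/enorm1_dot3 vv /enorm1_dot3 ww]] [uv [vw uw]]].
rewrite -[\det _]/(triple R u v w) => uvw_gt0.
apply/eqP; rewrite -(eqrXn2 (n := 2)) ?ltW // expr1n; apply/eqP.
rewrite -(det1 R 3) expr2 -[X in _ * X]det_tr -det_mulmx; congr (\det _).
apply/matrixP => i j; rewrite [LHS]mxE [RHS]mxE.
transitivity (dot3 (nth 0 [:: u; v; w] i) (nth 0 [:: u; v; w] j)).
  by apply: eq_bigr => k _; rewrite !mxE.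
have [vu wv wu] : [/\ dot3 v u = 0, dot3 w v = 0 & dot3 w u = 0].
  by split; rewrite dot3C.
by case: i => -[|[|[|//]]] ?; case: j => -[|[|[|//]]] ?.
Qed.

(** The factor r of the Jacobian cancels the r of the denominator, and what remains is continuous at
    r = 0, where the tube map takes the value [x s]. *)
Lemma polar_integrand_cvg (R : realType) (x : R -> 'rV[R]_3) (P : piece R)
    (f : 'rV[R]_3 -> R) (s theta : R) :
  smooth x -> smooth (pU P) -> smooth (pV P) ->
  continuous f -> continuous (ph P) ->
  right_handed_orthonormal (pU P s) (pV P s) (x^`()%classic s) ->
  polar_integrand x P f s theta r @[r --> 0^'+] -->
    f (x s) * ph P (x s) / (2 * pi).
Proof.
move=> sx sU sV cf ch /right_handed_orthonormal_triple uvw.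
set Y := cos theta *: (pU P)^`()%classic s + sin theta *: (pV P)^`()%classic s.
pose T (r : R) := tube x P r theta s.
pose m := triple R (pU P s) (pV P s) Y.
have cT : T r @[r --> 0^'+] --> x s.
  rewrite [X in _ --> X](_ : _ = T 0); last first.
    by rewrite /T /tube !mul0r !scale0r !addr0.
  apply: cvg_at_right_filter; apply: cvgD; first apply: cvgD.
  - exact: cvg_cst.
  - by apply: cvgZ; [apply: cvgM; [exact: cvg_id|exact: cvg_cst]|exact: cvg_cst].
  - by apply: cvgZ; [apply: cvgM; [exact: cvg_id|exact: cvg_cst]|exact: cvg_cst].
have cm : 1 + r * m @[r --> 0^'+] --> (1 : R).
  rewrite [X in _ --> X](_ : _ = 1 + 0 * m); last by rewrite mul0r addr0.
  apply: cvg_at_right_filter; apply: cvgD; first exact: cvg_cst.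
  by apply: cvgM; [exact: cvg_id|exact: cvg_cst].
have cfh : f (T r) * ph P (T r) * (1 + r * m) / (2 * pi) @[r --> 0^'+] -->
    f (x s) * ph P (x s) / (2 * pi).
  rewrite -(mulr1 (f (x s) * ph P (x s))); apply: cvgM; last exact: cvg_cst.
  apply: cvgM => //.
  by apply: cvgM; apply: cvg_comp cT _; [exact: cf|exact: ch].
(* The cancelled form agrees with the integrand only for nonzero r, which holds along [0^'+]. *)
apply: cvg_trans cfh; apply: near_eq_cvg; near=> r.
have r0 : r != 0 by rewrite gt_eqF //; near: r; exact: nbhs_right_gt.
rewrite /polar_integrand tube_jacobianE // uvw -/(T r) -/m.
have p0 : pi != 0 :> R by rewrite gt_eqF ?pi_gt0.
move: (f _) (ph _ _) (m) (pi : R) p0 => a b c p p0.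
by field; rewrite r0.
Unshelve. all: by end_near. Qed.

(** * Integrals over intervals, periods and supports *)

Lemma integrable_itv_continuous (R : realType) (F : R -> R) (a b : R) :
  continuous F ->
  (@lebesgue_measure R).-integrable `[a, b] (fun t => (F t)%:E).
Proof.
move=> cF; apply: continuous_compact_integrable; first exact: segment_compact.
exact: continuous_subspaceT.
Qed.

Lemma Rintegral_itv_shift (R : realType) (F : R -> R) (a b c : R) :
  a <= b -> continuous F ->
  \int[@lebesgue_measure R]_(t in `[a + c, b + c]) F t =
  \int[@lebesgue_measure R]_(t in `[a, b]) F (t + c).
Proof.
move=> ab cF; congr fine.
have dS t : is_derive t (1 : R) (fun y : R => y + c) 1.
  by apply: is_derive_eq; rewrite addr0.
have S1 : (fun y : R => y + c)^`()%classic = cst 1.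
  by apply/funext => t; rewrite derive1E; exact: derive_val.
have cS : continuous (fun y : R => y + c).
  by move=> t; apply: differentiable_continuous; apply/derivable1_diffP.
rewrite (@integration_by_substitution_increasing R (fun y => y + c)) //.
- by apply: eq_integral => t _; rewrite S1 /= fctE mulr1.
- by move=> y z _ _ yz; rewrite ltrD2r.
- by rewrite S1 => ? _; exact: cvg_cst.
- by rewrite S1; exact: is_cvg_cst.
- by rewrite S1; exact: is_cvg_cst.
- split; first by [].
  + by apply: cvg_at_right_filter; exact: cS.
  + by apply: cvg_at_left_filter; exact: cS.
- exact: continuous_subspaceT.
Qed.

Lemma Rintegral_itvD_continuous (R : realType) (F : R -> R) (a b c : R) :
  a <= b -> b <= c -> continuous F ->
  \int[@lebesgue_measure R]_(t in `[a, c]) F t =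
  \int[@lebesgue_measure R]_(t in `[a, b]) F t +
  \int[@lebesgue_measure R]_(t in `[b, c]) F t.
Proof.
move=> ab bc cF; have iF u v := @integrable_itv_continuous R F u v cF.
(* The difference of the integrals over [a, c] and [a, b] is one over ]b, c]; adding the endpoint b
   does not change it. *)
apply/eqP; rewrite addrC -subr_eq Rintegral_itvB ?bnd_simp //; apply/eqP.
apply: Rintegral_itv_obnd_cbnd; apply: integrableS (iF b c) => //.
by apply: subset_itvr; rewrite bnd_simp.
Qed.

(** For a <= b, the interval [a, b + L] is cut once at a + L and once at b. The pieces
    [a + L, b + L] and [a, b] have equal integrals by periodicity and cancel. *)
Lemma Rintegral_period (R : realType) (F : R -> R) (L a b : R) :
  0 <= L -> continuous F -> (forall t, F (t + L) = F t) ->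
  \int[@lebesgue_measure R]_(t in `[a, a + L]) F t =
  \int[@lebesgue_measure R]_(t in `[b, b + L]) F t.
Proof.
move=> L0 cF FL; wlog ab : a b / a <= b.
  by move=> wl; case/orP: (le_total a b) => /wl.
have shift : \int[@lebesgue_measure R]_(t in `[a + L, b + L]) F t =
    \int[@lebesgue_measure R]_(t in `[a, b]) F t.
  by rewrite Rintegral_itv_shift //; apply: eq_Rintegral => t _; rewrite FL.
have := @Rintegral_itvD_continuous R F a (a + L) (b + L).
rewrite (@Rintegral_itvD_continuous R F a b (b + L)) ?lerDl ?lerD2r // shift.
by move=> /(_ L0 ab cF); rewrite addrC => /addIr.
Qed.

(** A restriction [F \_ D] takes the default value [point] off [D]. This is 0 for real and extended
    real values, so the lemma serves both integrals and integrability. *)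
Lemma patch_vanish (T : Type) (U : pointedType) (D E : set T) (F : T -> U) :
  E `<=` D -> (forall t, D t -> F t != point -> E t) -> F \_ D = F \_ E.
Proof.
move=> ED FE; apply/funext => t; rewrite !patchE.
case: ifPn => [/set_mem Dt|Dt]; case: ifPn => // tE.
  by apply: contraNeq tE => /(FE _ Dt) /mem_set.
by case/negP: Dt; exact/mem_set/ED/set_mem.
Qed.

Lemma Rintegral_vanish (R : realType) (D E : set R) (F : R -> R) :
  E `<=` D -> (forall t, D t -> F t != 0 -> E t) ->
  \int[@lebesgue_measure R]_(t in D) F t = \int[@lebesgue_measure R]_(t in E) F t.
Proof.
move=> ED FE; rewrite Rintegral_mkcond [RHS]Rintegral_mkcond.
by rewrite (patch_vanish _ _ D E).
Qed.

Lemma integrable_vanish (R : realType) (D E : set R) (F : R -> R) :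
  measurable (D : set (measurableTypeR R)) ->
  measurable (E : set (measurableTypeR R)) ->
  E `<=` D -> (forall t, D t -> F t != 0 -> E t) ->
  (@lebesgue_measure R).-integrable E (fun t => (F t)%:E) ->
  (@lebesgue_measure R).-integrable D (fun t => (F t)%:E).
Proof.
move=> mD mE ED FE iE; apply: (integrable_mkcond _ mD).2.
rewrite (patch_vanish _ _ D E) //; last exact: (integrable_mkcond _ mE).1.
Qed.

Lemma Rintegral_sum (R : realType) (D : set R) (n : nat) (F : 'I_n -> R -> R) :
  measurable (D : set (measurableTypeR R)) ->
  (forall i, (@lebesgue_measure R).-integrable D (fun t => (F i t)%:E)) ->
  \int[@lebesgue_measure R]_(t in D) (\sum_i F i t) =
  \sum_i \int[@lebesgue_measure R]_(t in D) F i t.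
Proof.
move=> mD iF; rewrite /Rintegral.
under eq_integral do rewrite -sumEFin.
rewrite integral_sum // -sum_fine // => i _.
exact: integrable_fin_num.
Qed.

(** * Comparison of one piece with the whole curve *)

(** In a longer piece, [pa P] and [pa P + L] would both lie in [a, b) and give the same point at
    radius 0, against injectivity of the tube. *)
Lemma loop_piece_length (R : realType) (Sigma : set 'rV[R]_3)
    (x : R -> 'rV[R]_3) (P : piece R) (L : R) :
  0 < L -> (forall t, x (t + L) = x t) -> tubular Sigma x P ->
  pb P <= pa P + L.
Proof.
move=> L0 xL [eps0 inj _ _]; rewrite leNgt; apply/negP => ab.
have tube0 t : tube x P 0 0 t = x t by rewrite /tube !mul0r !scale0r !addr0.
have r0 : 0 <= (0 : R) < peps P by rewrite lexx.
have t0 : 0 <= (0 : R) < 2 * pi by rewrite lexx mulr_gt0 ?pi_gt0.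
have [] := inj 0 0 (pa P) 0 0 (pa P + L) r0 t0 _ r0 t0.
- by rewrite lexx (lt_trans _ ab) // ltrDl.
- by rewrite ab lerDl ltW.
- by rewrite !tube0 xL.
- by move=> _ /eqP; rewrite -[X in X == _]addr0 (inj_eq (addrI _)) lt_eqF.
Qed.

Lemma piece_line_integral (R : realType) (Sigma : set 'rV[R]_3)
    (x : R -> 'rV[R]_3) (J D : set R) (P : piece R) (F : 'rV[R]_3 -> R) :
  arc_length_param Sigma x J D -> admissible_piece Sigma x J P ->
  continuous (F \o x) -> (forall p, F p != 0 -> supp (ph P) p) ->
  (@lebesgue_measure R).-integrable D (fun s => (F (x s))%:E) /\
  \int[@lebesgue_measure R]_(s in `[pa P, pb P]) F (x s) =
  \int[@lebesgue_measure R]_(s in D) F (x s).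
Proof.
move=> [sx _ xJ hJD] [[ab abJ] _ _ tubP [_ suppP]] cF F0.
(* A nonzero value of [F] at [x s] places the point in the piece, but on a loop the parameter [t]
   found there may differ from [s] by periods. *)
have preimage s : J s -> F (x s) != 0 -> exists2 t, pa P <= t <= pb P & x t = x s.
  move=> Js /F0 Ps; have [t /= tab xt] : (x @` `[pa P, pb P]) (x s).
    by apply: suppP; split => //; rewrite -xJ; exists s.
  by exists t => //; rewrite in_itv in tab.
have iF u v := integrable_itv_continuous R (F \o x) u v cF.
case: hJD => [[itvJ _ -> [g _ gx]]|[JT [L L0 [-> xper]]]].
  have vanish s : J s -> F (x s) != 0 -> `[pa P, pb P]%classic s.
    (* On an arc the left inverse [g] of [x] forces the two parameters to coincide. *)
    move=> Js /(preimage _ Js)[t tab xts]; have ts : t = s.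
      by rewrite -(gx s Js) -xts gx //; apply: abJ; rewrite /= in_itv.
    by rewrite /= in_itv /= -ts.
  split; last by rewrite (Rintegral_vanish _ J `[pa P, pb P]%classic).
  apply: (@integrable_vanish _ _ `[pa P, pb P]%classic) => //.
  exact: measurable_realfun.is_interval_measurable.
split; first exact: iF.
have xL t : x (t + L) = x t by apply/esym/xper; exists 1; rewrite mul1r.
have bL := loop_piece_length _ _ _ _ _ L0 xL tubP.
(* The period [0, L] is moved so as to start where the piece starts and hence to contain it. *)
transitivity (\int[@lebesgue_measure R]_(s in `[pa P, pa P + L]) F (x s)); last first.
  rewrite (Rintegral_period _ (F \o x) L _ 0) ?add0r ?ltW //.
  by move=> t /=; rewrite xL.
move: bL; rewrite le_eqVlt => /predU1P[-> //|bL].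
(* The endpoint a + L is dropped: it gives the same point as a, so [F] may be nonzero there although
   a + L lies outside [a, b] in this case. *)
rewrite -[RHS]Rintegral_itv_bndo_bndc; last first.
  apply: integrableS (iF (pa P) (pa P + L)) => //.
  by apply: subset_itvl; rewrite bnd_simp.
apply/esym/Rintegral_vanish => [|s].
  by apply: subset_itvl; rewrite bnd_simp.
rewrite /= !in_itv /= => /andP[as_ sL] Fs.
have [|t /andP[at_ tb] /xper[k sk]] := preimage s _ Fs; first by rewrite JT.
(* Both [s] and [t] lie in [a, a + L), so their difference [k%:~R * L] is smaller than L in absolute
   value. *)
suff k0 : k = 0 by rewrite sk k0 mul0r addr0 at_ tb.
have kL : - L < k%:~R * L < L by lra.
have [k1 k2] : -1 < k /\ k < 1.
  rewrite -!(ltr_int R); move/andP: kL => [kL1 kL2]; split.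
    by rewrite -(ltr_pM2r L0) mulN1r.
  by rewrite -(ltr_pM2r L0) mul1r.
lia.
Qed.

(** * The radial delta and the sum over the pieces *)

Lemma test_function_continuous (R : realType) (f : 'rV[R]_3 -> R) :
  test_function f -> continuous f.
Proof. by move=> [/smooth_continuous]. Qed.

Lemma delta0_polar_integrand (R : realType) (Sigma : set 'rV[R]_3)
    (x : R -> 'rV[R]_3) (J : set R) (P : piece R) (f : 'rV[R]_3 -> R)
    (s theta : R) :
  smooth x -> continuous f -> admissible_piece Sigma x J P ->
  pa P <= s <= pb P ->
  delta0 (polar_integrand x P f s theta) = f (x s) * ph P (x s) / (2 * pi).
Proof.
move=> sx cf [_ [sU sV] frame _ [/test_function_continuous ch _]] sab.
apply: cvg_lim => //.
by apply: polar_integrand_cvg => //; exact: frame.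
Qed.

Theorem theorem1 (R : realType) (Sigma : set 'rV[R]_3)
    (hSigma : simple_smooth_curve Sigma) (hclosed : closed Sigma)
    (x : R -> 'rV[R]_3) (J D : set R)
    (hx : arc_length_param Sigma x J D)
    (f : 'rV[R]_3 -> R) (hf : test_function f)
    (n : nat) (P : 'I_n -> piece R)
    (hP : admissible_choice Sigma x J f P) :
  [/\ delta_rho_defined x P f,
      line_integrable x D f &
      delta_rho_integral x P f = line_integral x D f].
Proof.
have [sx _ xJ hJD] := hx; have [aP sumP] := hP.
have cf := test_function_continuous _ _ hf.
have ch i : continuous (ph (P i)).
  by have [_ _ _ _ [/test_function_continuous]] := aP i.
pose G i (p : 'rV[R]_3) := f p * ph (P i) p.
have cG i : continuous (G i \o x).
  have cx := smooth_continuous _ _ _ _ sx.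
  move=> s; apply: (@continuous_comp _ _ _ x (G i)); first exact: cx.
  by apply: (@continuousM _ _ f (ph (P i))); [exact: cf|exact: ch].
(* The radial limit does not depend on theta, so integrating over an interval of length 2 pi cancels
   the denominator 2 pi. *)
have inner i s : pa (P i) <= s <= pb (P i) ->
    \int[@lebesgue_measure R]_(theta in `[0, 2 * pi])
      delta0 (polar_integrand x (P i) f s theta) = G i (x s).
  move=> sab.
  under eq_Rintegral do rewrite (delta0_polar_integrand _ Sigma _ J) //.
  have pi0 := @pi_gt0 R.
  rewrite Rintegral_cst; last by [].
  rewrite [X in fine X](lebesgue_measure_itv `[0, 2 * pi]) /= lte_fin mulr_gt0 //=.
  by rewrite subr0 divfK // mulf_neq0 // gt_eqF.
have piece_int i := piece_line_integral _ _ _ _ _ (P i) (G i) hx (aP i) (cG i).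
have Gsupp i p : G i p != 0 -> supp (ph (P i)) p.
  by rewrite mulf_eq0 negb_or => /andP[_ hp]; exact: subset_closure.
have mD : measurable (D : set (measurableTypeR R)).
  case: hJD => [[itvJ _ -> _]|[_ [L _ [-> _]]]] //.
  exact: measurable_realfun.is_interval_measurable.
have DJ : D `<=` J by case: hJD => [[_ _ -> _]|[-> _]].
(* Where [f] vanishes both sides are 0; elsewhere the point lies in [supp f], and the cut-offs sum
   to 1 near it, in particular at it. *)
have fG s : D s -> f (x s) = \sum_i G i (x s).
  move=> Ds; rewrite -mulr_sumr.
  have [->|f0] := eqVneq (f (x s)) 0; first by rewrite mul0r.
  have /nbhs_singleton -> : \forall q \near x s, \sum_i ph (P i) q = 1.
    by apply: sumP; [rewrite -xJ; exists s => //; exact: DJ|exact: subset_closure].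
  by rewrite mulr1.
have iG i : (@lebesgue_measure R).-integrable D (fun s => (G i (x s))%:E).
  by have [] := piece_int i (Gsupp i).
split.
- move=> i; split.
  + move=> s theta sab _; have [_ [sU sV] frame _ _] := aP i.
    by apply: cvgP; apply: polar_integrand_cvg => //; exact: frame.
  + move=> s sab.
    apply: (eq_integrable _ (fun=> (G i (x s) / (2 * pi))%:E)) => //.
      by move=> theta _; rewrite (delta0_polar_integrand _ Sigma _ J).
    by apply: (integrable_itv_continuous _ (cst _)) => ?; exact: cvg_cst.
  + have := integrable_itv_continuous _ (G i \o x) (pa (P i)) (pb (P i)) (cG i).
    apply: eq_integrable => // s /set_mem /=.
    by rewrite in_itv /= => sab; rewrite inner.
- have := integrable_sum mD (index_enum 'I_n) (P := xpredT) (fun i _ => iG i).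
  apply: eq_integrable => // s /set_mem Ds.
  by rewrite sumEFin fG.
(* Both sides become the sum over i of the integrals of [G i] along the curve: the right by the
   partition of unity, the left piece by piece. *)
- transitivity (\int[@lebesgue_measure R]_(s in D) \sum_i G i (x s)); last first.
    by apply: eq_Rintegral => s /set_mem Ds; rewrite fG.
  rewrite Rintegral_sum //; apply: eq_bigr => i _.
  have [_ <-] := piece_int i (Gsupp i).
  by apply: eq_Rintegral => s /set_mem /=; rewrite in_itv /=; exact: inner.
Qed.
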